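(* There exists a finitely generated, elementary subgroup $G$ of the group $\mathrm{Diff}^\infty_+(\mathbb{S}^1)$ of orientation-preserving smooth ($C^\infty$) circle diffeomorphisms, such that $G$ has at most $2$ fixed points and $G$ is not isomorphic (as an abstract group) to any subgroup of $\mathrm{PSL}(2,\mathbb{R})$.
   Context: $\mathbb{S}^1=\mathbb{R}/\mathbb{Z}$. A subgroup of $\mathrm{Homeo}_+(\mathbb{S}^1)$ (orientation-preserving circle homeomorphisms) is elementary if it preserves a Borel probability measure on $\mathbb{S}^1$. A group $G$ of homeomorphisms of $\mathbb{S}^1$ has at most $N$ fixed points if every non-trivial element of $G$ has at most $N$ fixed points in $\mathbb{S}^1$. *)

(* Defs.v *)
From HB Require Import structures.
From mathcomp Require Import all_boot all_order all_algebra.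
From mathcomp Require Import generic_quotient ring_quotient archimedean.
From mathcomp Require Import all_classical all_reals all_analysis.

Set Implicit Arguments.
Unset Strict Implicit.
Unset Printing Implicit Defensive.

Import Order.TTheory GRing.Theory Num.Theory.
Import numFieldNormedType.Exports.

Local Open Scope classical_set_scope.
Local Open Scope card_scope.
Local Open Scope quotient_scope.
Local Open Scope ring_scope.

(* A subgroup is a boolean predicate [G : groupClosed gT]; classically every
   subset is given by such a predicate, so this is no restriction.            *)
Section AbstractGroups.
Variables gT hT : groupType.

Definition finitely_generated (G : groupClosed gT) : Prop :=
  exists2 s : seq gT, {subset s <= G} &
    forall H : groupClosed gT, {subset s <= H} -> {subset G <= H}.

(* The values of [f] outside [G] are irrelevant.                              *)
Definition isomorphic_groups (G : groupClosed gT) (H : groupClosed hT) : Prop :=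
  exists f : gT -> hT,
    [/\ {in G &, {morph f : x y / (x * y)%g}},
        {in G &, injective f} &
        [set f x | x in [set` G]] = [set` H]].

End AbstractGroups.

Section PSL2.
Variable F : fieldType.

Definition SL2 : Type := {A : 'M[F]_2 | \det A == 1}.
HB.instance Definition _ := Choice.on SL2.

Lemma SL2_det (A : SL2) : \det (val A) = 1.
Proof. exact/eqP/(valP A). Qed.

Lemma SL2_unit (A : SL2) : val A \in unitmx.
Proof. by rewrite unitmxE SL2_det unitr1. Qed.

Fact SL2_one_subproof : \det (1%:M : 'M[F]_2) == 1.
Proof. by rewrite det1. Qed.
Definition SL2_one : SL2 := Sub 1%:M SL2_one_subproof.

Fact SL2_mul_subproof (A B : SL2) : \det (val A *m val B) == 1.
Proof. by rewrite det_mulmx !SL2_det mulr1. Qed.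
Definition SL2_mul (A B : SL2) : SL2 := Sub (val A *m val B) (SL2_mul_subproof A B).

Fact SL2_inv_subproof (A : SL2) : \det (invmx (val A)) == 1.
Proof. by rewrite det_inv SL2_det invr1. Qed.
Definition SL2_inv (A : SL2) : SL2 := Sub (invmx (val A)) (SL2_inv_subproof A).

Fact SL2_mulA : associative SL2_mul.
Proof. by move=> A B C; apply: val_inj; rewrite /= mulmxA. Qed.
Fact SL2_mul1 : left_id SL2_one SL2_mul.
Proof. by move=> A; apply: val_inj; rewrite /= mul1mx. Qed.
Fact SL2_mulr1 : right_id SL2_one SL2_mul.
Proof. by move=> A; apply: val_inj; rewrite /= mulmx1. Qed.
Fact SL2_mulV : left_inverse SL2_one SL2_inv SL2_mul.
Proof. by move=> A; apply: val_inj; rewrite /= mulVmx ?SL2_unit. Qed.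
Fact SL2_mulrV : right_inverse SL2_one SL2_inv SL2_mul.
Proof. by move=> A; apply: val_inj; rewrite /= mulmxV ?SL2_unit. Qed.

HB.instance Definition _ :=
  isGroup.Build SL2 SL2_mulA SL2_mul1 SL2_mulr1 SL2_mulV SL2_mulrV.

Definition SL2_eqpm (A B : SL2) : bool :=
  (val A == val B) || (val A == - val B).

Lemma SL2_eqpmP (A B : SL2) :
  reflect (exists b : bool, val A = (-1) ^+ b *: val B) (SL2_eqpm A B).
Proof.
apply: (iffP orP) => [[] /eqP ->|[[] ->]].
- by exists false; rewrite expr0 scale1r.
- by exists true; rewrite expr1 scaleN1r.
- by right; rewrite expr1 scaleN1r.
- by left; rewrite expr0 scale1r.
Qed.

Fact SL2_eqpm_equiv : equiv_class_of SL2_eqpm.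
Proof.
split=> [A|A B|B A C].
- by rewrite /SL2_eqpm eqxx.
- by rewrite /SL2_eqpm eq_sym; congr orb; rewrite -eqr_oppLR eq_sym.
- move=> /SL2_eqpmP[b eb] /SL2_eqpmP[c ec]; apply/SL2_eqpmP.
  by exists (b (+) c); rewrite eb ec scalerA signr_addb.
Qed.
Canonical SL2_eqpm_equiv_rel := EquivRelPack SL2_eqpm_equiv.
Canonical SL2_eqpm_encModRel := defaultEncModRel SL2_eqpm.

Definition PSL2 : Type := {eq_quot SL2_eqpm}.
HB.instance Definition _ := Choice.on PSL2.
HB.instance Definition _ := EqQuotient.on PSL2.

Definition PSL2_one : PSL2 := \pi_PSL2 (1%g : SL2).
Definition PSL2_mul (x y : PSL2) : PSL2 := \pi_PSL2 (repr x * repr y)%g.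
Definition PSL2_inv (x : PSL2) : PSL2 := \pi_PSL2 (repr x)^-1%g.

Lemma PSL2_eqP (A B : SL2) :
  reflect (\pi_PSL2 A = \pi_PSL2 B) (SL2_eqpm A B).
Proof. by apply: (iffP idP) => [h|h]; [apply/eqmodP | move/eqmodP: h]. Qed.

Lemma repr_PSL2 (A : SL2) : SL2_eqpm (repr (\pi_PSL2 A)) A.
Proof. by apply/PSL2_eqP; rewrite reprK. Qed.

Lemma pi_PSL2M (A B : SL2) :
  PSL2_mul (\pi_PSL2 A) (\pi_PSL2 B) = \pi_PSL2 (A * B)%g.
Proof.
apply/PSL2_eqP/SL2_eqpmP => /=.
have /SL2_eqpmP[b ->] := repr_PSL2 A; have /SL2_eqpmP[c ->] := repr_PSL2 B.
by exists (b (+) c); rewrite -scalemxAl -scalemxAr scalerA signr_addb.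
Qed.

Lemma pi_PSL2V (A : SL2) : PSL2_inv (\pi_PSL2 A) = \pi_PSL2 A^-1%g.
Proof.
apply/PSL2_eqP/SL2_eqpmP => /=.
have /SL2_eqpmP[b ->] := repr_PSL2 A.
by exists b; rewrite invmxZ ?invr_sign ?unitmxZ ?SL2_unit ?unitrX ?unitrN1.
Qed.

Fact PSL2_mulA : associative PSL2_mul.
Proof.
elim/quotW=> x; elim/quotW=> y; elim/quotW=> z.
by rewrite (pi_PSL2M y z) (pi_PSL2M x y) !pi_PSL2M mulgA.
Qed.
Fact PSL2_mul1 : left_id PSL2_one PSL2_mul.
Proof. by elim/quotW=> x; rewrite pi_PSL2M mul1g. Qed.
Fact PSL2_mulr1 : right_id PSL2_one PSL2_mul.
Proof. by elim/quotW=> x; rewrite pi_PSL2M mulg1. Qed.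
Fact PSL2_mulV : left_inverse PSL2_one PSL2_inv PSL2_mul.
Proof. by elim/quotW=> x; rewrite pi_PSL2V pi_PSL2M mulVg. Qed.
Fact PSL2_mulrV : right_inverse PSL2_one PSL2_inv PSL2_mul.
Proof. by elim/quotW=> x; rewrite pi_PSL2V pi_PSL2M mulgV. Qed.

HB.instance Definition _ :=
  isGroup.Build PSL2 PSL2_mulA PSL2_mul1 PSL2_mulr1 PSL2_mulV PSL2_mulrV.

End PSL2.

Section Circle.
Variable R : realType.

(* [Num.int] is a qualifier; the quotient construction needs a predicate. *)
Definition Zset : {pred R} := fun x => x \is a Num.int.

Fact Zset_closed : zmod_closed Zset.
Proof. by split=> [|x y]; [exact: rpred0 | exact: rpredB]. Qed.
HB.instance Definition _ := GRing.isZmodClosed.Build R Zset Zset_closed.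

Definition RmodZ : Type := Quotient.quot Zset.
HB.instance Definition _ := GRing.Zmodule.on RmodZ.
HB.instance Definition _ := EqQuotient.on RmodZ.

Definition circle : Type := quotient_topology RmodZ.
HB.instance Definition _ := Quotient.on circle.
HB.instance Definition _ := PointedTopological.on circle.

Lemma pi_circleP (x y : R) :
  \pi_circle x = \pi_circle y <-> x - y \is a Num.int.
Proof.
have <- : (x == y %[mod Quotient.quot Zset]) = (x - y \is a Num.int).
  by rewrite -Quotient.idealrBE.
by split=> [xy|/eqP]; first exact/eqP.
Qed.

Definition is_lift (F : R -> R) (f : circle -> circle) : Prop :=
  forall x, f (\pi_circle x) = \pi_circle (F x).

(* [F] is a homeomorphism of the line, as is every increasing bijection. *)
Definition orientation_preserving (f : circle -> circle) : Prop :=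
  exists F : R -> R,
    [/\ bijective F, {homo F : x y / x < y} & is_lift F f].

Record homeo_plus := HomeoPlus {
  homeo_fun :> circle -> circle;
  homeo_inv : circle -> circle;
  homeo_funK : cancel homeo_fun homeo_inv;
  homeo_invK : cancel homeo_inv homeo_fun;
  homeo_fun_continuous : continuous homeo_fun;
  homeo_inv_continuous : continuous homeo_inv;
  homeo_orientation : orientation_preserving homeo_fun }.

HB.instance Definition _ := gen_eqMixin homeo_plus.
HB.instance Definition _ := gen_choiceMixin homeo_plus.

Lemma homeo_plusP (f g : homeo_plus) : homeo_fun f =1 homeo_fun g -> f = g.
Proof.
case: f g => [f f' fK f'K cf cf' of_] [g g' gK g'K cg cg' og] /= /funext fg.
subst g; have f'g' : f' = g'.
  by apply/funext => x; rewrite -[x in LHS]g'K fK.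
by subst g'; congr HomeoPlus; exact: Prop_irrelevance.
Qed.

Fact homeo_one_orientation : orientation_preserving id.
Proof. by exists id; split => //; exists id. Qed.
Definition homeo_one : homeo_plus :=
  @HomeoPlus id id (fun=> erefl) (fun=> erefl)
    (fun=> cvg_id) (fun=> cvg_id) homeo_one_orientation.

Section Comp.
Variables f g : homeo_plus.

Fact homeo_comp_continuous : continuous (homeo_fun f \o homeo_fun g).
Proof.
by move=> x; apply: continuous_comp; exact: homeo_fun_continuous.
Qed.
Fact homeo_comp_inv_continuous : continuous (homeo_inv g \o homeo_inv f).
Proof.
by move=> x; apply: continuous_comp; exact: homeo_inv_continuous.
Qed.
Fact homeo_comp_orientation :
  orientation_preserving (homeo_fun f \o homeo_fun g).
Proof.
have [F [bF iF lF]] := homeo_orientation f.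
have [G [bG iG lG]] := homeo_orientation g.
exists (F \o G); split => [|x y /iG /iF //|x]; first exact: bij_comp.
by rewrite /= lG lF.
Qed.
Definition homeo_mul : homeo_plus :=
  HomeoPlus (can_comp (homeo_funK f) (homeo_funK g))
    (can_comp (homeo_invK g) (homeo_invK f))
    homeo_comp_continuous homeo_comp_inv_continuous homeo_comp_orientation.

Fact homeo_inv_orientation : orientation_preserving (homeo_inv f).
Proof.
have [F [[G FK GK] iF lF]] := homeo_orientation f.
exists G; split => [|x y xy|x]; first by exists F.
- by rewrite ltNge; apply/negP => /(ltW_homo iF); rewrite !GK leNgt xy.
- by rewrite -[x in LHS]GK -lF homeo_funK.
Qed.
Definition homeo_V : homeo_plus :=
  HomeoPlus (@homeo_invK f) (@homeo_funK f)
    (@homeo_inv_continuous f) (@homeo_fun_continuous f) homeo_inv_orientation.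
End Comp.

Fact homeo_mulA : associative homeo_mul.
Proof. by move=> f g h; exact: homeo_plusP. Qed.
Fact homeo_mul1 : left_id homeo_one homeo_mul.
Proof. by move=> f; exact: homeo_plusP. Qed.
Fact homeo_mulr1 : right_id homeo_one homeo_mul.
Proof. by move=> f; exact: homeo_plusP. Qed.
Fact homeo_mulV : left_inverse homeo_one homeo_V homeo_mul.
Proof. by move=> f; apply: homeo_plusP => x; exact: homeo_funK. Qed.
Fact homeo_mulrV : right_inverse homeo_one homeo_V homeo_mul.
Proof. by move=> f; apply: homeo_plusP => x; exact: homeo_invK. Qed.

HB.instance Definition _ :=
  isGroup.Build homeo_plus homeo_mulA homeo_mul1 homeo_mulr1
    homeo_mulV homeo_mulrV.

Definition smooth (F : R -> R) : Prop :=
  forall n x, derivable (derive1n n F) x 1.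

(* The projection R -> R/Z is a local diffeomorphism, and a continuous lift of
   a map of the circle is unique up to an integer constant: a map of the circle
   is smooth for the quotient smooth structure iff it has a smooth lift.      *)
Definition circle_smooth (f : circle -> circle) : Prop :=
  exists2 F : R -> R, smooth F & is_lift F f.

Definition smooth_diffeo (g : homeo_plus) : Prop :=
  circle_smooth g /\ circle_smooth (homeo_inv g).

Definition borel_circle : Type := g_sigma_algebraType (@open circle).
HB.instance Definition _ := Measurable.on borel_circle.

Definition elementary (G : groupClosed homeo_plus) : Prop :=
  exists mu : probability borel_circle R,
    forall g, g \in G -> forall A : set borel_circle, measurable A ->
      mu (homeo_fun g @^-1` A) = mu A.

Definition at_most_fixed_points (G : groupClosed homeo_plus) (N : nat) : Prop :=
  forall g, g \in G -> g != 1%g -> [set x | homeo_fun g x = x] #<= `I_N.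

End Circle.

(* Main.v *)
Require Import Defs.
From HB Require Import structures.
From mathcomp Require Import all_boot all_order all_algebra.
From mathcomp Require Import generic_quotient ring_quotient archimedean.
From mathcomp Require Import all_classical all_reals all_analysis.
From mathcomp Require Import ring lra zify.

(** The group is the fundamental group of the Klein bottle, generated by [g]
    and [d] with the single relation [d g d = g].

    It does not embed in PSL(2, R).  If [A] and [B] in SL(2, R) satisfy
    [B A B = A] up to sign, then [C = B ^ 2] satisfies [A C = C ^-1 A], hence
    [A] anticommutes with the traceless matrix [C - C ^-1].  A real 2 x 2 matrix
    of nonzero trace anticommutes with no nonzero traceless matrix, so either
    [A] has trace 0, and then [A ^ 2 = - 1], or [C ^ 2 = 1]
    ([skew_traceless], [PSL2_klein_relation]).  Thus [g] or [d] would be sent to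
    a torsion element, while the Klein bottle group has no torsion.

    It acts on the circle as follows.  Cut the circle at 0 and 1/2, and take on
    each of the two arcs a copy of a flow without fixed points inside the arc.
    Let [g] be the half turn composed with the time 1 of the flow on both arcs,
    and let [d] be the time [sqrt 2] of the flow on one arc and its time
    [- sqrt 2] on the other.  The half turn exchanges the arcs, so that it
    conjugates [d] to its inverse, which is the Klein bottle relation
    ([kleinM]).  If [i] is odd then [g ^ i d ^ j] exchanges the arcs and has no
    fixed point.  If [i] is even it moves the arcs by the times
    [i + j sqrt 2] and [i - j sqrt 2], which vanish only for [i = j = 0]; so a
    nontrivial element fixes at most the two endpoints ([klein_fixed]).  The
    endpoints form an invariant set, and the mean of the Dirac masses there is
    an invariant probability ([klein_elementary]).

    The delicate point is smoothness at the endpoints.  As [d] moves points by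
    opposite times on the two sides of an endpoint, the flow has to be
    infinitely tangent to the identity there.  The flow used here is the
    translation flow [y |-> y + t] of the line read through
    [y = sinh (1 / (1 - x) - 1 / x)], for [x] between 0 and 1.  Near the ends
    [exp (- |z|)], with [z = 1 / (1 - x) - 1 / x], is a flat function of [x],
    and the translation changes [z] by the logarithm of 1 plus a flat term;
    since [z] has simple poles, the map induced on [x] is tangent to the
    identity to infinite order.  The lemma [flow_closed] makes this global and
    free of estimates: it gives a formula for the time-[t] map, extended by the
    identity, that is built from [exp (- 1 / x)] extended by 0, field
    operations, and square roots and logarithms of positive functions. *)

Set Implicit Arguments.
Unset Strict Implicit.
Unset Printing Implicit Defensive.

Import Order.TTheory GRing.Theory Num.Theory.
Import numFieldNormedType.Exports.

Local Open Scope classical_set_scope.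
Local Open Scope card_scope.
Local Open Scope quotient_scope.
Local Open Scope ring_scope.

(** * Smooth functions on the line *)

Section Smoothness.
Variable R : realType.
Implicit Types (F G : R -> R) (n : nat).

(** The recursion is on the derivative, uniformly in the function, so that each
    closure property below is an induction on [n] in which the derivative of the
    compound function is again a compound of functions already covered. *)
Fixpoint times_derivable n F : Prop :=
  if n is m.+1 then
    (forall x : R, derivable F x 1) /\ times_derivable m (derive1 F)
  else True.

Lemma times_derivable_smooth F : (forall n, times_derivable n F) -> smooth F.
Proof.
move=> cF n; move: (cF n.+1).
elim: n F {cF} => [|n IHn] F [dF cF] //.
by rewrite /derive1n iterSr; exact: IHn.
Qed.

Lemma times_derivableS n F F' :
  (forall x : R, is_derive x 1 F (F' x)) -> times_derivable n F' ->
  times_derivable n.+1 F.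
Proof.
move=> dF cF'; split=> [x|]; first by have [] := dF x.
suff -> : (derive1 F) = F' by [].
by apply/funext => x; rewrite derive1E; have [] := dF x.
Qed.

Lemma times_derivable_is_derive n F : times_derivable n.+1 F ->
  (forall x : R, is_derive x 1 F (derive1 F x)) /\
  times_derivable n (derive1 F).
Proof.
by move=> [dF cF]; split=> // x; split; [exact: dF | rewrite derive1E].
Qed.

Lemma times_derivableW n F : times_derivable n.+1 F -> times_derivable n F.
Proof. by elim: n F => [//|n IHn] F [dF /IHn cF]. Qed.

Lemma times_derivable_cst n (c : R) : times_derivable n (fun=> c).
Proof.
elim: n c => [//|n IHn] c.
by apply: (@times_derivableS _ _ (fun=> 0)); exact: IHn.
Qed.

Lemma times_derivable_id n : times_derivable n id.
Proof.
case: n => [//|n]; apply: (@times_derivableS _ _ (fun=> 1)).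
exact: times_derivable_cst.
Qed.

Lemma times_derivableD n F G : times_derivable n F -> times_derivable n G ->
  times_derivable n (fun x => F x + G x).
Proof.
elim: n F G => [//|n IHn] F G /times_derivable_is_derive[dF cF].
move=> /times_derivable_is_derive[dG cG].
by apply: times_derivableS (IHn _ _ cF cG) => x; exact: is_deriveD.
Qed.

Lemma times_derivableM n F G : times_derivable n F -> times_derivable n G ->
  times_derivable n (fun x => F x * G x).
Proof.
elim: n F G => [//|n IHn] F G cF cG.
have [dF cF'] := times_derivable_is_derive cF.
have [dG cG'] := times_derivable_is_derive cG.
have := times_derivableD (IHn _ _ (times_derivableW cF) cG')
                         (IHn _ _ (times_derivableW cG) cF').
exact: times_derivableS.
Qed.

Lemma times_derivableN n F : times_derivable n F ->
  times_derivable n (fun x => - F x).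
Proof.
move=> cF; have := times_derivableM (times_derivable_cst n (-1)) cF.
by under eq_fun do rewrite mulN1r.
Qed.

Lemma times_derivableB n F G : times_derivable n F -> times_derivable n G ->
  times_derivable n (fun x => F x - G x).
Proof. by move=> cF /times_derivableN; exact: times_derivableD. Qed.

Lemma times_derivableX n F k : times_derivable n F ->
  times_derivable n (fun x => F x ^+ k).
Proof.
move=> cF; elim: k => [|k IHk]; first exact: times_derivable_cst.
by under eq_fun do rewrite exprS; exact: times_derivableM.
Qed.

Lemma times_derivable_comp n F G : times_derivable n F -> times_derivable n G ->
  times_derivable n (fun x => F (G x)).
Proof.
elim: n F G => [//|n IHn] F G /times_derivable_is_derive[dF cF'] cG.
have [dG cG'] := times_derivable_is_derive cG.
have := times_derivableM (IHn _ _ cF' (times_derivableW cG)) cG'.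
exact: times_derivableS.
Qed.

(** The derivative of [1 / F] is [- F' / F ^ 2], in which [1 / F] itself occurs
    with one order of differentiability less. *)
Lemma times_derivableV n F : (forall x, F x != 0) -> times_derivable n F ->
  times_derivable n (fun x => (F x)^-1).
Proof.
move=> F0; elim: n => [//|n IHn] cF.
have [dF cF'] := times_derivable_is_derive cF.
have cV := IHn (times_derivableW cF).
have := times_derivableM (times_derivableN (times_derivableX 2 cV)) cF'.
apply: times_derivableS => x.
by rewrite exprVn; exact: is_deriveV.
Qed.

Lemma times_derivable_ln n F : (forall x, 0 < F x) -> times_derivable n F ->
  times_derivable n (fun x => ln (F x)).
Proof.
move=> F0; case: n => [//|n] cF.
have [dF cF'] := times_derivable_is_derive cF.
have cV : times_derivable n (fun x => (F x)^-1).
  by apply: times_derivableV (times_derivableW cF) => x; rewrite gt_eqF.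
have := times_derivableM cV cF'.
apply: times_derivableS => x.
by have := (is_derive1_comp (is_derive1_ln (F0 x)) (dF x)).
Qed.

Lemma times_derivable_sqrt n F : (forall x, 0 < F x) -> times_derivable n F ->
  times_derivable n (fun x => Num.sqrt (F x)).
Proof.
move=> F0; elim: n => [//|n IHn] cF.
have [dF cF'] := times_derivable_is_derive cF.
have cs := times_derivableM (times_derivable_cst n 2)
                            (IHn (times_derivableW cF)).
have cV : times_derivable n (fun x => (2 * Num.sqrt (F x))^-1).
  apply: times_derivableV cs => x.
  by rewrite mulf_neq0 ?pnatr_eq0 // gt_eqF // sqrtr_gt0.
have := times_derivableM cV cF'.
apply: times_derivableS => x.
by have := (is_derive1_comp (is_derive1_sqrt (F0 x)) (dF x)).
Qed.

(** Differentiability is local, and so is the value of the derivative; this is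
    what allows the lifts below to be described by a different formula near
    each point. *)
Lemma times_derivable_near n F :
  (forall x : R, exists2 G, times_derivable n G &
     \forall y \near x, F y = G y) ->
  times_derivable n F.
Proof.
elim: n F => [//|n IHn] F FG; split=> [x|].
  have [G [dG _] eqFG] := FG x; apply: near_eq_derivable (dG x).
  by apply: filterS eqFG => y.
apply: IHn => x; have [G [_ cG] eqFG] := FG x; exists (derive1 G) => //.
have := near_join eqFG; apply: filterS => y eqy.
by rewrite !derive1E; exact: near_eq_derive.
Qed.

(** The functions [x ^- n * exp (- 1 / x)], extended by 0 to the left of 0, are
    stable under differentiation up to linear combinations, which reduces the
    smoothness of [exp (- 1 / x)] to first derivatives. *)
Definition flat n (x : R) : R :=
  if 0 < x then x^-1 ^+ n * expR (- x^-1) else 0.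

(** One term of the exponential series,
    [(1 / x) ^ (n + 1) / (n + 1)! <= exp (1 / x)]. *)
Lemma flat_bound n x : `|flat n x| <= n.+1`!%:R * `|x|.
Proof.
rewrite /flat; case: ifPn => [x0|_]; last by rewrite normr0 mulr_ge0.
have y0 : 0 < x^-1 by rewrite invr_gt0.
rewrite !gtr0_norm ?mulr_gt0 ?exprn_gt0 ?expR_gt0// expRN.
rewrite ler_pdivrMr ?expR_gt0//.
have [f0 x_neq0] : 0 < n.+1`!%:R :> R /\ x != 0
  by rewrite ltr0n fact_gt0 gt_eqF.
have := expR_ge1Dxn n (ltW y0) => /(le_trans (ler_wpDl ler01 (lexx _))).
move=> /(ler_wpM2l (ltW (mulr_gt0 f0 x0))); apply: le_trans.
have -> // : n.+1`!%:R * x * (x^-1 ^+ n.+1 / n.+1`!%:R) = x^-1 ^+ n.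
by rewrite exprS; field; rewrite x_neq0 gt_eqF.
Qed.

(** Away from 0 this is calculus.  At 0 the difference quotient of [flat n] is
    [flat n.+1], which tends to 0 by [flat_bound]. *)
Lemma is_derive_flat n (x : R) :
  is_derive x 1 (flat n) (flat n.+2 x - n%:R * flat n.+1 x).
Proof.
have [x0|x0|->] := ltgtP x 0.
- have -> : flat n.+2 x - n%:R * flat n.+1 x = 0.
    by rewrite /flat ltNge (ltW x0) /= mulr0 subrr.
  apply: (@near_eq_is_derive _ _ _ (cst 0)).
  near=> y; rewrite /flat ltNge.
  have /ltW -> // : y < 0 by near: y; exact: lt_nbhsl.
- pose g y := y^-1 ^+ n * expR (- y^-1) : R.
  apply: (@near_eq_is_derive _ _ _ g).
    near=> y; rewrite /flat.
    have -> // : 0 < y by near: y; exact: lt_nbhsr.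
  have xn0 : x != 0 by rewrite gt_eqF.
  have dV : is_derive x 1 (fun y : R => y^-1) (- x ^- 2).
    apply: is_derive_eq; first exact: (@is_deriveV _ id x 1 1 xn0).
    by rewrite /GRing.scale /= mulr1.
  have dVN : is_derive x 1 (fun y : R => - y^-1) (x ^- 2).
    by apply: is_derive_eq; rewrite opprK.
  have dE := @is_derive1_comp _ expR (fun y => - y^-1) _ _ _
    (is_derive_expR (- x^-1)) dVN.
  have dX : is_derive x 1 (fun y : R => y^-1 ^+ n)
      ((n%:R * x^-1 ^+ n.-1) *: - x ^- 2).
    have -> : (fun y : R => y^-1 ^+ n) = (fun y : R => y^-1) ^+ n.
      by rewrite exprfctE.
    exact: is_deriveX.
  have dg := is_deriveM dX dE.
  apply: (is_derive_eq dg).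
  rewrite /flat x0 /GRing.scale /= -exprVn.
  case: n {g dX dg} => [|n] /=; first by rewrite expr0; ring.
  by rewrite !exprS; ring.
- rewrite /flat ltxx mulr0 subr0; apply/is_derive1_caratheodory.
  exists (flat n.+1); split.
  + move=> z; rewrite ltxx !subr0 /flat.
    case: ifPn => [z0|]; last by rewrite mul0r.
    by rewrite exprS; field; rewrite gt_eqF.
  + have fl0 : flat n.+1 0 = 0 by rewrite /flat ltxx.
    suff : flat n.+1 z @[z --> (0 : R)] --> (0 : R).
      by rewrite /prop_for /continuous_at fl0.
    apply/cvgr0Pnorm_le => e e0.
    near=> z; apply: le_trans (flat_bound _ _) _.
    have f0 : 0 < n.+2`!%:R :> R by rewrite ltr0n fact_gt0.
    rewrite -ler_pdivlMl//.
    by near: z; apply: (@nbhs0_le R R); rewrite mulr_gt0 ?invr_gt0.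
  + by rewrite /flat ltxx.
Unshelve. all: by end_near. Qed.

Lemma times_derivable_flat m n : times_derivable m (flat n).
Proof.
elim: m n => [//|m IHm] n.
apply: (@times_derivableS _ _ (fun x => flat n.+2 x - n%:R * flat n.+1 x)).
  exact: is_derive_flat.
apply: times_derivableB => //.
by apply: times_derivableM => //; exact: times_derivable_cst.
Qed.

End Smoothness.

(** * A fixed-point-free flow on the unit interval *)

Section Flow.
Variable R : realType.
Implicit Types (x y z t : R).

Definition sinh z : R := (expR z - expR (- z)) / 2.
Definition arsinh y : R := ln (y + Num.sqrt (y ^+ 2 + 1)).

Lemma arsinh_arg_gt0 y : 0 < y + Num.sqrt (y ^+ 2 + 1).
Proof.
have s0 : 0 <= Num.sqrt (y ^+ 2 + 1) by exact: sqrtr_ge0.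
have s2 : Num.sqrt (y ^+ 2 + 1) ^+ 2 = y ^+ 2 + 1.
  by rewrite sqr_sqrtr// addr_ge0// sqr_ge0.
by nra.
Qed.

Lemma sinhK : cancel sinh arsinh.
Proof.
move=> z; rewrite /arsinh /sinh expRN.
have e0 := expR_gt0 z; set e := expR z in e0 *.
have en0 : e != 0 by rewrite gt_eqF.
have -> : ((e - e^-1) / 2) ^+ 2 + 1 = ((e + e^-1) / 2) ^+ 2 by field.
rewrite sqrtr_sqr ger0_norm; last first.
  by rewrite divr_ge0// addr_ge0// ?invr_ge0 ltW.
have -> : (e - e^-1) / 2 + (e + e^-1) / 2 = e by field.
by rewrite /e expRK.
Qed.

Lemma arsinhK : cancel arsinh sinh.
Proof.
move=> y; have w0 := arsinh_arg_gt0 y.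
rewrite /sinh expRN /arsinh lnK ?posrE//.
have s2 : Num.sqrt (y ^+ 2 + 1) ^+ 2 = y ^+ 2 + 1.
  by rewrite sqr_sqrtr// addr_ge0// sqr_ge0.
set s := Num.sqrt _ in w0 s2 *.
have wn0 : y + s != 0 by rewrite gt_eqF.
have -> : (y + s)^-1 = s - y.
  apply: (mulfI wn0); rewrite mulfV//.
  by transitivity (s ^+ 2 - y ^+ 2); [rewrite s2|]; ring.
by field.
Qed.

Lemma sinh_lt : {homo sinh : z z' / z < z'}.
Proof.
move=> z z' zz'; rewrite /sinh ltr_pM2r ?invr_gt0//.
by rewrite ltrB// ltr_expR// ltrN2.
Qed.

(** An increasing diffeomorphism from the unit interval to the line with simple
    poles at the ends, so that [exp (- |chart x|)] is flat there; solving a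
    quadratic equation inverts it explicitly. *)
Definition chart x : R := (1 - x)^-1 - x^-1.
Definition chart_inv z : R := (1 + z / (2 + Num.sqrt (z ^+ 2 + 4))) / 2.

Lemma chart_sqrt z : Num.sqrt (z ^+ 2 + 4) ^+ 2 = z ^+ 2 + 4.
Proof. by rewrite sqr_sqrtr// addr_ge0// sqr_ge0. Qed.

Lemma chart_inv_itv z : 0 < chart_inv z < 1.
Proof.
rewrite /chart_inv.
have s0 : 0 <= Num.sqrt (z ^+ 2 + 4) by exact: sqrtr_ge0.
have s2 := chart_sqrt z.
set s := Num.sqrt _ in s0 s2 *.
have w0 : 0 < 2 + s by lra.
have lt1 : z / (2 + s) < 1 by rewrite ltr_pdivrMr//; nra.
have gt1 : - 1 < z / (2 + s) by rewrite ltr_pdivlMr//; nra.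
by apply/andP; split; lra.
Qed.

Lemma chart_invK : cancel chart_inv chart.
Proof.
move=> z; have := chart_inv_itv z.
have s0 : 0 <= Num.sqrt (z ^+ 2 + 4) by exact: sqrtr_ge0.
have s2 := chart_sqrt z.
rewrite /chart /chart_inv; set s := Num.sqrt _ in s0 s2 *.
have w0 : 2 + s != 0 by rewrite gt_eqF//; lra.
set y := z / (2 + s) => /andP[x0 x1].
have zE : z = y * (2 + s) by rewrite /y divfK.
have y0 : 1 + y != 0 by rewrite gt_eqF//; lra.
have y1 : 1 - y != 0 by rewrite gt_eqF//; lra.
have yE : (1 + y) * (1 - y) = 4 / (2 + s).
  apply: (mulIf w0); apply: (mulIf w0).
  transitivity ((2 + s) ^+ 2 - z ^+ 2); first by rewrite zE; ring.
  transitivity (4 + 4 * s + (s ^+ 2 - z ^+ 2)); first by ring.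
  by rewrite s2; field.
transitivity (4 * y / ((1 + y) * (1 - y))); first by field; lra.
by rewrite yE zE; field.
Qed.

Lemma chartK x : 0 < x < 1 -> chart_inv (chart x) = x.
Proof.
move=> /andP[x0 x1].
have xn0 : x != 0 by rewrite gt_eqF.
have xn1 : 1 - x != 0 by rewrite subr_eq0 gt_eqF.
rewrite /chart_inv /chart.
have -> : ((1 - x)^-1 - x^-1) ^+ 2 + 4 =
    ((1 - x *+ 2 * (1 - x)) / (x * (1 - x))) ^+ 2.
  by rewrite mulr2n; field; rewrite xn0 xn1.
have q0 : 0 < x * (1 - x) by rewrite mulr_gt0 ?subr_gt0.
rewrite sqrtr_sqr ger0_norm; last by rewrite divr_ge0 ?(ltW q0)//; nra.
by rewrite mulr2n; field; rewrite xn0 xn1; apply/eqP => h; nra.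
Qed.

Lemma chart_lt x x' : 0 < x -> x' < 1 -> x < x' -> chart x < chart x'.
Proof.
move=> x0 x1' xx'; rewrite /chart ltrB//.
  by rewrite ltf_pV2 ?posrE; lra.
by rewrite ltf_pV2 ?posrE; lra.
Qed.

(** The hyperbolic sine leaves a coordinate in which translations have a time-t
    map computable at both ends at once: [arsinh (sinh z + t)] is a logarithm of
    an algebraic function of [exp z]. *)
Definition height x : R := sinh (chart x).
Definition height_inv y : R := chart_inv (arsinh y).

Lemma height_inv_itv y : 0 < height_inv y < 1.
Proof. exact: chart_inv_itv. Qed.

Lemma height_invK : cancel height_inv height.
Proof. by move=> y; rewrite /height /height_inv chart_invK arsinhK. Qed.

Lemma heightK x : 0 < x < 1 -> height_inv (height x) = x.
Proof. by move=> x01; rewrite /height_inv sinhK chartK. Qed.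

Lemma height_lt x x' : 0 < x -> x' < 1 -> x < x' -> height x < height x'.
Proof. by move=> x0 x1 xx'; apply/sinh_lt/chart_lt. Qed.

(** The inverse of an increasing function is increasing. *)
Lemma height_inv_lt : {homo height_inv : y y' / y < y'}.
Proof.
move=> y y' yy'; have /andP[h0 h1] := height_inv_itv y.
have /andP[h0' h1'] := height_inv_itv y'.
rewrite ltNge le_eqVlt; apply/negP => /orP[/eqP|/height_lt].
  by move/(congr1 height); rewrite !height_invK => e; move: yy'; rewrite e ltxx.
by rewrite !height_invK => /(_ h0' h1); lra.
Qed.

Definition flow t x : R := if 0 < x < 1 then height_inv (height x + t) else x.

Lemma flow_in t x : 0 < x < 1 -> flow t x = height_inv (height x + t).
Proof. by rewrite /flow => ->. Qed.

Lemma flow_out t x : ~~ (0 < x < 1) -> flow t x = x.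
Proof. by rewrite /flow => /negbTE ->. Qed.

Lemma flow_itv t x : (0 < flow t x < 1) = (0 < x < 1).
Proof.
by rewrite /flow; case: ifPn => [_|/negbTE//]; exact: height_inv_itv.
Qed.

Lemma flow0 x : flow 0 x = x.
Proof. by rewrite /flow; case: ifPn => // x01; rewrite addr0 heightK. Qed.

Lemma flowD s t x : flow (s + t) x = flow s (flow t x).
Proof.
have [x01|x01] := boolP (0 < x < 1); last first.
  by rewrite !flow_out// flow_out// flow_itv.
rewrite [RHS]flow_in ?flow_itv// !(flow_in _ x01) height_invK.
by rewrite -addrA [s + t]addrC.
Qed.

Lemma flow_fixed t x : 0 < x < 1 -> flow t x = x -> t = 0.
Proof.
move=> x01; rewrite flow_in// => /(congr1 height); rewrite height_invK.
by move/(canRL (addKr _)); rewrite addNr.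
Qed.

Lemma flow_lt t : {homo flow t : x x' / x < x'}.
Proof.
move=> x x' xx'.
have [x01|x01] := boolP (0 < x < 1); have [x01'|x01'] := boolP (0 < x' < 1).
- rewrite !flow_in//; apply: height_inv_lt; rewrite ltrD2r.
  by move/andP: x01 => [? _]; move/andP: x01' => [_ ?]; exact: height_lt.
- rewrite (flow_out _ x01'); have := x01; rewrite -(flow_itv t).
  move/andP: x01 => [? ?] /andP[_ ft1]; apply: (lt_le_trans ft1).
  by rewrite leNgt; apply: contra x01' => ->; rewrite andbT; lra.
- rewrite (flow_out _ x01); have := x01'; rewrite -(flow_itv t).
  move/andP: x01' => [? ?] /andP[ft0 _]; apply: le_lt_trans ft0.
  by rewrite leNgt; apply: contra x01 => ->; lra.
- by rewrite !flow_out.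
Qed.

End Flow.

(** * The flow extends smoothly by the identity *)

Section ClosedForm.
Variable R : realType.
Implicit Types (x y z t : R).

(** On the unit interval [exp (chart x)] is [flat_left x / flat_right x].  Hence
    the next definitions are the values of sech and tanh at [chart x], in a form
    that makes sense, and is smooth, on the whole line. *)
Definition flat_right x : R := flat 0 (1 - x).
Definition flat_left x : R := flat 0 x.
Definition flat_norm x : R := flat_right x ^+ 2 + flat_left x ^+ 2.
Definition sech_chart x : R := 2 * flat_right x * flat_left x / flat_norm x.
Definition tanh_chart x : R :=
  (flat_left x ^+ 2 - flat_right x ^+ 2) / flat_norm x.

Lemma flat_gt0 x : 0 < x -> 0 < flat 0 x.
Proof. by move=> x0; rewrite /flat x0 mul1r expR_gt0. Qed.

Lemma flat_le0 n x : x <= 0 -> flat n x = 0.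
Proof. by move=> x0; rewrite /flat ltNge x0. Qed.

Lemma flat_norm_gt0 x : 0 < flat_norm x.
Proof.
rewrite /flat_norm; have [x0|x0] := ltP 0 x.
  by rewrite ltr_wpDl ?sqr_ge0// exprn_gt0// flat_gt0.
by rewrite ltr_wpDr ?sqr_ge0// exprn_gt0// flat_gt0//; lra.
Qed.

Lemma sech_tanh_sqr x : tanh_chart x ^+ 2 + sech_chart x ^+ 2 = 1.
Proof.
have := flat_norm_gt0 x; rewrite /tanh_chart /sech_chart /flat_norm.
set a := flat_right x; set b := flat_left x => d0.
by field; rewrite gt_eqF.
Qed.

Lemma sech_chart_ge0 x : 0 <= sech_chart x.
Proof.
rewrite divr_ge0 ?(ltW (flat_norm_gt0 x))// !mulr_ge0//.
  by rewrite /flat_right /flat; case: ifP => // _; rewrite mul1r expR_ge0.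
by rewrite /flat_left /flat; case: ifP => // _; rewrite mul1r expR_ge0.
Qed.

Lemma sech_chart_out x : ~~ (0 < x < 1) -> sech_chart x = 0.
Proof.
rewrite negb_and -!leNgt /sech_chart => /orP[x0|x1].
  by rewrite /flat_left flat_le0// mulr0 mul0r.
by rewrite /flat_right flat_le0 ?subr_le0// mulr0 !mul0r.
Qed.

(** With [T] and [W] the values of tanh and sech, the height is [T / W] and its
    translate by [t] is [(T + t W) / W]; the hyperbolic cosine that goes with it
    is [radius / W].  Multiplying by [W] removes the poles. *)
Definition radius_sqr t x : R :=
  sech_chart x ^+ 2 + (tanh_chart x + t * sech_chart x) ^+ 2.

Lemma radius_sqr_gt0 t x : 0 < radius_sqr t x.
Proof.
rewrite lt_neqAle addr_ge0 ?sqr_ge0// andbT eq_sym /radius_sqr.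
rewrite paddr_eq0 ?sqr_ge0// !sqrf_eq0; apply/negP => /andP[/eqP w0].
rewrite w0 mulr0 addr0 => /eqP T0.
by have := sech_tanh_sqr x; rewrite w0 T0 expr0n addr0 => /eqP;
  rewrite eq_sym oner_eq0.
Qed.

Definition radius t x : R := Num.sqrt (radius_sqr t x).

Lemma sqr_radius t x : radius t x ^+ 2 =
  1 + 2 * tanh_chart x * (t * sech_chart x) + (t * sech_chart x) ^+ 2.
Proof.
rewrite sqr_sqrtr ?ltW ?radius_sqr_gt0// /radius_sqr.
transitivity (tanh_chart x ^+ 2 + sech_chart x ^+ 2 +
  2 * tanh_chart x * (t * sech_chart x) + (t * sech_chart x) ^+ 2).
  by ring.
by rewrite sech_tanh_sqr.
Qed.

(** If [W = 0] the claim is clear.  Otherwise [T] lies strictly between -1 and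
    1, while [t W >= 1 + radius] would give [t W (1 + T) <= 0] after squaring; the
    other sign is symmetric under [(t, T) |-> (- t, - T)]. *)
Lemma chart_shift_arg_gt0 t x : 0 < 1 + radius t x - t * sech_chart x /\
  0 < 1 + radius t x + t * sech_chart x.
Proof.
have r0 : 0 <= radius t x by exact: sqrtr_ge0.
have r2 := sqr_radius t x.
have [/eqP w0|w0] := boolP (sech_chart x == 0).
  by rewrite w0 mulr0 addr0 subr0; split; lra.
have w_gt0 : 0 < sech_chart x by rewrite lt_neqAle eq_sym w0 sech_chart_ge0.
have TW := sech_tanh_sqr x.
have [T1 T2] : -1 < tanh_chart x /\ tanh_chart x < 1.
  by split; nra.
set v := t * sech_chart x in r2 *; set T := tanh_chart x in T1 T2 r2.
set r := radius t x in r0 r2 *.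
by split; rewrite ltNge; apply/negP => h; nra.
Qed.

(** The displacement of [chart x] under the translation of the height by [t].
    If [k] is this displacement, then [tanh (k / 2)] is the quotient of
    [sinh (z + k) - sinh z = t] by [cosh (z + k) + cosh z], and the latter is
    [(radius + 1) / W]; so [exp k = (1 + radius + t W) / (1 + radius - t W)]. *)
Definition chart_shift t x : R :=
  ln (1 + radius t x + t * sech_chart x) -
  ln (1 + radius t x - t * sech_chart x).

Lemma chart_shift_out t x : ~~ (0 < x < 1) -> chart_shift t x = 0.
Proof.
by move=> x01; rewrite /chart_shift sech_chart_out// mulr0 addr0 subr0 subrr.
Qed.

Lemma expR_chart x : 0 < x < 1 -> expR (chart x) = flat_left x / flat_right x.
Proof.
move=> /andP[x0 x1]; rewrite /flat_left /flat_right /flat.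
rewrite x0 subr_gt0 x1 !expr0 !mul1r.
by rewrite -expRB opprK addrC.
Qed.

(** After clearing denominators, the exponential of this identity is
    [(1 + T) (1 + radius + t W) = (T + t W + radius) (1 + radius - t W)], which
    is [sqr_radius]. *)
Lemma arsinh_chart_shift t x : 0 < x < 1 ->
  arsinh (height x + t) = chart x + chart_shift t x.
Proof.
move=> x01.
have a0 : 0 < flat_right x by apply: flat_gt0; lra.
have b0 : 0 < flat_left x by apply: flat_gt0; lra.
have d0 := flat_norm_gt0 x.
have [m0 p0] := chart_shift_arg_gt0 t x.
have w0 : 0 < sech_chart x by rewrite divr_gt0// !mulr_gt0.
have wn0 : sech_chart x != 0 by rewrite gt_eqF.
have eE : expR (chart x) = (1 + tanh_chart x) / sech_chart x.
  rewrite expR_chart// /tanh_chart /sech_chart /flat_norm.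
  by field; rewrite ?gt_eqF//.
have hE : height x = tanh_chart x / sech_chart x.
  rewrite /height /sinh expRN expR_chart// /tanh_chart /sech_chart.
  by field; rewrite ?gt_eqF//.
rewrite /arsinh hE.
have -> : (tanh_chart x / sech_chart x + t) ^+ 2 + 1 =
    radius_sqr t x / sech_chart x ^+ 2 by rewrite /radius_sqr; field.
rewrite sqrtrM ?(ltW (radius_sqr_gt0 t x))// -exprVn sqrtr_sqr.
rewrite ger0_norm ?invr_ge0 ?ltW// -/(radius t x).
apply: expR_inj; rewrite expRD /chart_shift expRB eE !lnK ?posrE//; last first.
  have : 0 < radius t x by rewrite sqrtr_gt0 radius_sqr_gt0.
  have : radius t x ^+ 2 =
      sech_chart x ^+ 2 + (tanh_chart x + t * sech_chart x) ^+ 2.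
    by rewrite sqr_sqrtr// ltW// radius_sqr_gt0.
  set r := radius t x => r2 r_gt0.
  have : 0 < tanh_chart x + t * sech_chart x + r by nra.
  have -> : tanh_chart x / sech_chart x + t + r / sech_chart x =
    (tanh_chart x + t * sech_chart x + r) / sech_chart x by field.
  by move=> h; rewrite divr_gt0.
have r2 := sqr_radius t x.
apply: (mulIf wn0); apply: (mulIf (lt0r_neq0 m0)).
rewrite [RHS](_ : _ = (1 + tanh_chart x) *
  (1 + radius t x + t * sech_chart x)); last first.
  by field; rewrite wn0 gt_eqF.
rewrite [LHS](_ : _ = (tanh_chart x + t * sech_chart x + radius t x) *
  (1 + radius t x - t * sech_chart x)); last by field.
apply/eqP; rewrite -subr_eq0; apply/eqP.
transitivity (radius t x ^+ 2 - (1 + 2 * tanh_chart x * (t * sech_chart x) +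
  (t * sech_chart x) ^+ 2)); first by ring.
by rewrite r2 subrr.
Qed.

(** With [q = x (1 - x)], the displaced chart is [flow_numer / q].  The next
    definitions rewrite [chart_inv] of that quotient without dividing by [q],
    which changes sign at 0 and 1. *)
Definition flow_numer t x : R := 2 * x - 1 + chart_shift t x * (x * (1 - x)).
Definition flow_radicand t x : R :=
  4 * (x * (1 - x)) ^+ 2 + flow_numer t x ^+ 2.
Definition flow_denom t x : R :=
  2 * (x * (1 - x)) + Num.sqrt (flow_radicand t x).

(** Outside the interval the displacement vanishes, and the radicand is the
    square of [1 - 2 x (1 - x)], which is positive there. *)
Lemma flow_closed_out t x : ~~ (0 < x < 1) ->
  flow_numer t x = 2 * x - 1 /\ flow_denom t x = 1.
Proof.
move=> x01; rewrite /flow_denom /flow_radicand /flow_numer.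
rewrite chart_shift_out// mul0r addr0.
split=> //.
have -> : 4 * (x * (1 - x)) ^+ 2 + (2 * x - 1) ^+ 2 =
  (1 - 2 * (x * (1 - x))) ^+ 2 by ring.
rewrite sqrtr_sqr ger0_norm; first by ring.
by move: x01; rewrite negb_and -!leNgt => /orP[|]; nra.
Qed.

Lemma flow_radicand_gt0 t x : 0 < flow_radicand t x.
Proof.
have [x01|x01] := boolP (0 < x < 1).
  rewrite /flow_radicand ltr_wpDr ?sqr_ge0//.
  by move/andP: x01 => [? ?]; rewrite !(mulr_gt0, exprn_gt0)//; lra.
have [nE _] := flow_closed_out t x01.
rewrite /flow_radicand nE.
by move: x01; rewrite negb_and -!leNgt => /orP[|]; nra.
Qed.

Lemma flow_denom_gt0 t x : 0 < flow_denom t x.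
Proof.
have [x01|x01] := boolP (0 < x < 1); last first.
  by have [_ ->] := flow_closed_out t x01.
rewrite /flow_denom ltr_wpDr ?sqrtr_ge0// !mulr_gt0//; lra.
Qed.

Lemma flow_closed t x : flow t x = (1 + flow_numer t x / flow_denom t x) / 2.
Proof.
have [x01|x01] := boolP (0 < x < 1); last first.
  by have [-> ->] := flow_closed_out t x01; rewrite flow_out//; field.
rewrite flow_in// /height_inv arsinh_chart_shift// /chart_inv.
congr ((1 + _) / 2).
set q := x * (1 - x).
have q0 : 0 < q by rewrite mulr_gt0; lra.
have qn0 : q != 0 by rewrite gt_eqF.
have x0 : x != 0 by rewrite gt_eqF//; lra.
have x1 : 1 - x != 0 by rewrite gt_eqF//; lra.
have -> : chart x + chart_shift t x = flow_numer t x / q.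
  by rewrite /chart /flow_numer /q; field; rewrite x0 x1.
have -> : (flow_numer t x / q) ^+ 2 + 4 = flow_radicand t x / q ^+ 2.
  by rewrite /flow_radicand -/q; field.
rewrite sqrtrM ?(ltW (flow_radicand_gt0 t x))// -exprVn sqrtr_sqr.
rewrite ger0_norm ?invr_ge0 ?ltW//.
have dn0 : flow_denom t x != 0 by rewrite gt_eqF// flow_denom_gt0.
move: dn0; rewrite /flow_denom -/q; set s := Num.sqrt _ => dn0.
by field; rewrite dn0 qn0.
Qed.

Lemma times_derivable_flow n t : times_derivable n (flow t).
Proof.
have cst := @times_derivable_cst R n.
have cid := @times_derivable_id R n.
have cA : times_derivable n flat_right.
  apply: (@times_derivable_comp _ _ (flat 0) (fun x => 1 - x)).
    exact: times_derivable_flat.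
  exact: times_derivableB.
have cB : times_derivable n flat_left by exact: times_derivable_flat.
have cD : times_derivable n (fun x => (flat_norm x)^-1).
  apply: times_derivableV => [x|]; first by rewrite gt_eqF// flat_norm_gt0.
  by apply: times_derivableD; exact: times_derivableX.
have cW : times_derivable n sech_chart.
  by do 3![apply: times_derivableM => //].
have cT : times_derivable n tanh_chart.
  apply: times_derivableM => //.
  by apply: times_derivableB; exact: times_derivableX.
have cv : times_derivable n (fun x => t * sech_chart x).
  exact: times_derivableM.
have cr : times_derivable n (radius t).
  apply: times_derivable_sqrt => [x|]; first exact: radius_sqr_gt0.
  apply: times_derivableD; apply: times_derivableX => //.
  exact: times_derivableD.
have cr1 : times_derivable n (fun x => 1 + radius t x).
  exact: times_derivableD.
have ck : times_derivable n (chart_shift t).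
  apply: times_derivableB; apply: times_derivable_ln.
  - by move=> x; have [] := chart_shift_arg_gt0 t x.
  - exact: times_derivableD.
  - by move=> x; have [] := chart_shift_arg_gt0 t x.
  - exact: times_derivableB.
have cq : times_derivable n (fun x => x * (1 - x)).
  by apply: times_derivableM => //; exact: times_derivableB.
have cN : times_derivable n (flow_numer t).
  apply: times_derivableD; last exact: times_derivableM.
  by apply: times_derivableB => //; exact: times_derivableM.
have cd : times_derivable n (fun x => (flow_denom t x)^-1).
  apply: times_derivableV => [x|]; first by rewrite gt_eqF// flow_denom_gt0.
  apply: times_derivableD; first exact: times_derivableM.
  apply: times_derivable_sqrt => [x|]; first exact: flow_radicand_gt0.
  apply: times_derivableD; last exact: times_derivableX.
  by apply: times_derivableM => //; exact: times_derivableX.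
have -> : flow t = fun x => (1 + flow_numer t x * (flow_denom t x)^-1) * 2^-1.
  by apply/funext => x; exact: flow_closed.
apply: times_derivableM => //; apply: times_derivableD => //.
exact: times_derivableM.
Qed.

End ClosedForm.

(** * Lifts to the line *)

(** Conjugation by [g ^ n] sends [d] to [d ^ parity_sign n]. *)
Definition parity_sign (n : int) : int := (-1) ^ n.

Lemma parity_signD m n : parity_sign (m + n) = parity_sign m * parity_sign n.
Proof. by rewrite /parity_sign exprzDr ?unitrN1. Qed.

Lemma parity_sign_even k : parity_sign (2 * k) = 1.
Proof. by rewrite /parity_sign -exprz_exp exp1rz. Qed.

Lemma parity_signNM n : parity_sign (- n) * parity_sign n = 1.
Proof. by rewrite -parity_signD addNr. Qed.

Section Tiles.
Variable R : realType.
Implicit Types (i j k l n m : int) (x y : R).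

Local Notation sqrt2 := (Num.sqrt 2 : R).

(** The square of an integer has an even 2-adic valuation, and twice a nonzero
    square has an odd one. *)
Lemma sqrt2_irrational i j : i%:~R + j%:~R * sqrt2 = 0 -> i = 0 /\ j = 0.
Proof.
move=> e.
have e2 : i ^+ 2 = 2 * j ^+ 2.
  apply: (@intr_inj R); rewrite !(rmorphM, rmorphXn) /=.
  have -> : i%:~R = - (j%:~R * sqrt2) :> R by apply/eqP; rewrite -addr_eq0 e.
  by rewrite mulrNN -expr2 exprMn sqr_sqrtr// mulrC.
have e3 : (`|i| ^ 2 = 2 * `|j| ^ 2)%N.
  by move/(congr1 absz): e2; rewrite abszM !abszX.
have j0 : `|j|%N = 0%N.
  apply/eqP; rewrite -leqn0 leqNgt; apply/negP => j0.
  have /(congr1 (logn 2)) := e3; rewrite lognM ?expn_gt0 ?j0// !lognX.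
  by rewrite (@logn_prime 2 2)//= => /(congr1 odd);
    rewrite !mul2n /= !odd_double.
move: e3; rewrite j0 => /eqP; rewrite muln0 expn_eq0 andbT.
by rewrite !absz_eq0 => /eqP ->; split=> //; apply/eqP; rewrite -absz_eq0 j0.
Qed.

(** The circle is unrolled at twice its length, so that the two arcs become the
    unit intervals [[n, n + 1]] with [n] even and with [n] odd.  The pair
    [(i, j)] stands for the element [g ^ i d ^ j]. *)
Definition tile_time i j n : R := i%:~R + (parity_sign n * j)%:~R * sqrt2.

Definition tile_map i j x : R :=
  (i + Num.floor x)%:~R +
  flow (tile_time i j (Num.floor x)) (x - (Num.floor x)%:~R).

Lemma floor_bounds x : (Num.floor x)%:~R <= x < (Num.floor x)%:~R + 1.
Proof. by have := floor_itv x; rewrite intrD. Qed.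

Lemma frac_itv x : 0 <= x - (Num.floor x)%:~R < 1.
Proof.
have /andP[? ?] := floor_bounds x.
by apply/andP; split; lra.
Qed.

Lemma flow_half_open (t x : R) : 0 <= x < 1 -> 0 <= flow t x < 1.
Proof.
move=> /andP[x0 x1]; have [x01|] := boolP (0 < x < 1).
  by have := x01; rewrite -(flow_itv t) => /andP[/ltW -> ->].
by move=> /[dup] /(flow_out t) ->; rewrite x0 x1.
Qed.

Lemma floor_tile_map i j x : Num.floor (tile_map i j x) = i + Num.floor x.
Proof.
apply: floor_def; rewrite /tile_map [in X in _ < X]intrD.
have /andP[? ?] := flow_half_open (tile_time i j (Num.floor x)) (frac_itv x).
by apply/andP; split; lra.
Qed.

(** The shift by [k] carries the interval [n] to the interval [n + k] and so
    changes the sign of the contribution of [j] if [k] is odd: this is the group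
    law of the Klein bottle group. *)
Lemma tile_map_comp i j k l x :
  tile_map i j (tile_map k l x) = tile_map (i + k) (parity_sign k * j + l) x.
Proof.
rewrite /tile_map floor_tile_map -/(tile_map k l x) addrA; congr (_ + _).
rewrite /tile_map [_ + flow _ _]addrC addrK -flowD; congr flow.
rewrite /tile_time parity_signD !mulrDr !intrD !intrM; ring.
Qed.

Lemma tile_map00 x : tile_map 0 0 x = x.
Proof.
by rewrite /tile_map /tile_time mulr0 mul0r addr0 flow0 add0r addrC subrK.
Qed.

Lemma tile_mapD i j x k :
  tile_map i j (x + (2 * k)%:~R) = tile_map i j x + (2 * k)%:~R.
Proof.
have fE : Num.floor (x + (2 * k)%:~R) = Num.floor x + 2 * k.
  apply: floor_def; have /andP[? ?] := floor_bounds x.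
  by rewrite !intrD; apply/andP; split; lra.
rewrite /tile_map fE /tile_time parity_signD parity_sign_even mulr1.
rewrite -[in RHS]addrAC; congr (_ + flow _ _); first by rewrite -intrD addrA.
by rewrite intrD; ring.
Qed.

Lemma tile_map_lt i j : {homo tile_map i j : x y / x < y}.
Proof.
move=> x y xy.
have : (Num.floor x <= Num.floor y) by exact: le_floor (ltW xy).
rewrite le_eqVlt => /orP[/eqP e|lt_xy].
  rewrite /tile_map e ltrD2l; apply: flow_lt; lra.
have := floor_itv (tile_map i j x); have := floor_itv (tile_map i j y).
rewrite !floor_tile_map => /andP[? _] /andP[_ ?].
apply: (@lt_le_trans _ _ (i + Num.floor x + 1)%:~R) => //.
apply: (@le_trans _ _ (i + Num.floor y)%:~R) => //.
by rewrite ler_int; lia.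
Qed.

Lemma tile_map_int i j n : tile_map i j n%:~R = (i + n)%:~R.
Proof. by rewrite /tile_map intrKfloor subrr flow_out ?ltxx// addr0. Qed.

(** On each side of [n] one of the two extended flows is the identity.  Their
    sum minus the identity is therefore a formula valid on both sides, smooth
    since the extended flows are smooth at the ends of their intervals. *)
Lemma tile_map_near i j n y : (n - 1)%:~R < y < (n + 1)%:~R ->
  tile_map i j y = i%:~R + (flow (tile_time i j (n - 1)) (y - (n - 1)%:~R)
    + flow (tile_time i j n) (y - n%:~R) - (y - n%:~R)) + (n - 1)%:~R.
Proof.
move=> /andP[y1 y2]; have [yn|yn] := ltP y n%:~R.
  have fE : Num.floor y = n - 1 by apply: floor_def; rewrite (ltW y1) subrK.
  rewrite /tile_map fE (@flow_out _ _ (y - n%:~R)) ?intrD; first by ring.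
  by rewrite negb_and -leNgt; apply/orP; left; lra.
have fE : Num.floor y = n by apply: floor_def; rewrite yn.
rewrite /tile_map fE (@flow_out _ _ (y - (n - 1)%:~R)) ?intrD; first by ring.
by rewrite negb_and -!leNgt; apply/orP; right; lra.
Qed.

Lemma times_derivable_tile_map p i j : times_derivable p (tile_map i j).
Proof.
apply: times_derivable_near => x.
have cst := @times_derivable_cst R p.
have cid := @times_derivable_id R p.
pose n := Num.floor x.
pose T m := flow (tile_time i j m).
exists (fun y => i%:~R + (T (n - 1) (y - (n - 1)%:~R)
    + T n (y - n%:~R) - (y - n%:~R)) + (n - 1)%:~R).
  have cs m : times_derivable p (fun y => y - m%:~R) by exact: times_derivableB.
  have cT m : times_derivable p (fun y => T m (y - m%:~R)).
    apply: (times_derivable_comp (F := T m)) => //.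
    exact: times_derivable_flow.
  apply: times_derivableD => //; apply: times_derivableD => //.
  by apply: times_derivableB => //; exact: times_derivableD.
have /andP[x0 x1] := floor_itv x.
have xn1 : (n - 1)%:~R < x by apply: lt_le_trans x0; rewrite ltr_int -/n; lia.
near=> y; apply: tile_map_near; apply/andP; split.
  by near: y; exact: lt_nbhsr.
by near: y; exact: lt_nbhsl.
Unshelve. all: by end_near. Qed.

Definition line_lift i j x : R := tile_map i j (2 * x) / 2.

Lemma line_lift_comp i j k l x :
  line_lift i j (line_lift k l x) = line_lift (i + k) (parity_sign k * j + l) x.
Proof.
by rewrite /line_lift [2 * (_ / 2)]mulrC divfK ?pnatr_eq0// tile_map_comp.
Qed.

Lemma line_lift00 x : line_lift 0 0 x = x.
Proof. by rewrite /line_lift tile_map00 mulrC mulKf ?pnatr_eq0. Qed.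

Lemma line_liftD i j x k : line_lift i j (x + k%:~R) = line_lift i j x + k%:~R.
Proof.
rewrite /line_lift mulrDr -[2 * k%:~R](intrM _ 2 k) tile_mapD mulrDl intrM.
congr (_ + _).
by rewrite mulrC mulrA mulVf ?mul1r// pnatr_eq0.
Qed.

Lemma line_lift_lt i j : {homo line_lift i j : x y / x < y}.
Proof.
move=> x y xy; rewrite /line_lift ltr_pM2r ?invr_gt0//; apply: tile_map_lt; lra.
Qed.

Lemma line_lift_smooth i j : smooth (line_lift i j).
Proof.
apply: times_derivable_smooth => p.
have cst := @times_derivable_cst R p.
have cid := @times_derivable_id R p.
apply: times_derivableM => //.
apply: (times_derivable_comp (F := tile_map i j)).
  exact: times_derivable_tile_map.
exact: times_derivableM.
Qed.

Lemma line_lift_continuous i j : continuous (line_lift i j).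
Proof.
move=> x; have : derivable (line_lift i j) x 1 := @line_lift_smooth i j 0%N x.
by move/derivable1_diffP/differentiable_continuous.
Qed.

Lemma line_lift_inv_l i j :
  cancel (line_lift i j) (line_lift (- i) (- (parity_sign (- i) * j))).
Proof.
move=> x; rewrite line_lift_comp mulrN mulrA [parity_sign i * _]mulrC.
rewrite parity_signNM mul1r !addNr.
exact: line_lift00.
Qed.

Lemma line_lift_inv_r i j :
  cancel (line_lift (- i) (- (parity_sign (- i) * j))) (line_lift i j).
Proof. by move=> x; rewrite line_lift_comp addrN addrN line_lift00. Qed.

(** A point that returns to itself modulo 1 returns to the same position in its
    interval; if that position is interior then the time of the flow is 0, and
    irrationality of the square root of 2 leaves only the trivial element. *)
Lemma line_lift_int_fixed i j x (k : int) : line_lift i j x = x + k%:~R ->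
  (exists2 n : int, 2 * x = n%:~R & i = 2 * k) \/ (i = 0 /\ j = 0).
Proof.
move=> e.
have te : tile_map i j (2 * x) = 2 * x + (2 * k)%:~R.
  rewrite -[LHS](divfK (_ : 2 != 0)) ?pnatr_eq0// -/(line_lift i j x) e intrM.
  by ring.
set y := 2 * x in te *.
have fE : i = 2 * k.
  have := floor_tile_map i j y; rewrite te.
  have -> : Num.floor (y + (2 * k)%:~R) = Num.floor y + 2 * k.
    apply: floor_def; have /andP[? ?] := floor_bounds y.
    by rewrite !intrD; apply/andP; split; lra.
  by lia.
have /andP[f0 f1] := frac_itv y.
have [y0|y0] := eqVneq (y - (Num.floor y)%:~R) 0.
  left; exists (Num.floor y) => //; exact: subr0_eq.
right.
have y01 : 0 < y - (Num.floor y)%:~R < 1 by rewrite lt_neqAle eq_sym y0 f0.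
have /(flow_fixed y01) : flow (tile_time i j (Num.floor y))
    (y - (Num.floor y)%:~R) = y - (Num.floor y)%:~R.
  by move: te; rewrite {1}/tile_map {1}fE intrD; lra.
move/sqrt2_irrational => [-> aj]; split=> //.
have := parity_signNM (Num.floor y); move/eqP: aj.
by rewrite mulf_eq0 => /orP[/eqP ->|/eqP//]; rewrite mulr0.
Qed.

End Tiles.

(** * The group of circle diffeomorphisms *)

Section KleinGroup.
Variable R : realType.
Implicit Types (i j k l n : int) (x y : R).

Local Notation S1 := (circle R).
Local Notation pi := (\pi_S1 : R -> S1).

Definition circle_map i j (p : S1) : S1 := pi (line_lift i j (repr p)).

Lemma circle_map_lift i j : is_lift (line_lift i j) (circle_map i j).
Proof.
move=> x; apply/pi_circleP.
have /pi_circleP/intrP[k kE] : pi (repr (pi x)) = pi x by rewrite reprK.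
have -> : repr (pi x) = x + k%:~R by rewrite -kE addrC subrK.
by rewrite line_liftD addrC addKr intr_int.
Qed.

Lemma circle_map_comp i j k l p :
  circle_map i j (circle_map k l p) =
  circle_map (i + k) (parity_sign k * j + l) p.
Proof. by rewrite {2 3}/circle_map circle_map_lift line_lift_comp. Qed.

Lemma circle_map00 p : circle_map 0 0 p = p.
Proof. by rewrite /circle_map line_lift00 reprK. Qed.

Lemma circle_map_inv_l i j :
  cancel (circle_map i j) (circle_map (- i) (- (parity_sign (- i) * j))).
Proof.
move=> p; rewrite [circle_map i j p]/circle_map.
by rewrite circle_map_lift line_lift_inv_l reprK.
Qed.

Lemma circle_map_inv_r i j :
  cancel (circle_map (- i) (- (parity_sign (- i) * j))) (circle_map i j).
Proof.
move=> p; rewrite [circle_map (- i) _ _]/circle_map.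
by rewrite circle_map_lift line_lift_inv_r reprK.
Qed.

Lemma circle_map_continuous i j : continuous (circle_map i j).
Proof.
apply/quotient_continuous.
have -> : circle_map i j \o pi = pi \o line_lift i j.
  by apply/funext => x; exact: circle_map_lift.
move=> x; apply: continuous_comp; first exact: line_lift_continuous.
exact: pi_continuous.
Qed.

Lemma circle_map_orientation i j : orientation_preserving (circle_map i j).
Proof.
exists (line_lift i j); split; [|exact: line_lift_lt|exact: circle_map_lift].
exists (line_lift (- i) (- (parity_sign (- i) * j)));
  [exact: line_lift_inv_l|exact: line_lift_inv_r].
Qed.

Definition klein i j : homeo_plus R :=
  HomeoPlus (@circle_map_inv_l i j) (@circle_map_inv_r i j)
    (@circle_map_continuous i j)
    (@circle_map_continuous (- i) (- (parity_sign (- i) * j)))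
    (circle_map_orientation i j).

Lemma kleinM i j k l :
  (klein i j * klein k l)%g = klein (i + k) (parity_sign k * j + l).
Proof. by apply: homeo_plusP => p; exact: circle_map_comp. Qed.

Lemma klein00 : klein 0 0 = 1%g.
Proof. by apply: homeo_plusP => p; exact: circle_map00. Qed.

Lemma kleinV i j : (klein i j)^-1%g = klein (- i) (- (parity_sign (- i) * j)).
Proof. exact: homeo_plusP. Qed.

Lemma klein_smooth i j : smooth_diffeo (klein i j).
Proof.
by split; [exists (line_lift i j) |
           exists (line_lift (- i) (- (parity_sign (- i) * j)))];
   first [exact: line_lift_smooth | exact: circle_map_lift].
Qed.

Definition klein_set : {pred homeo_plus R} :=
  fun g => `[< exists i j, g = klein i j >].

Lemma klein_setP g : reflect (exists i j, g = klein i j) (g \in klein_set).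
Proof. exact: asboolP. Qed.

Fact klein_setM : mulg_closed klein_set.
Proof.
move=> g h /klein_setP[i [j ->]] /klein_setP[k [l ->]]; apply/klein_setP.
by exists (i + k), (parity_sign k * j + l); exact: kleinM.
Qed.
Fact klein_set1 : 1%g \in klein_set.
Proof. by apply/klein_setP; exists 0, 0; rewrite klein00. Qed.
Fact klein_setV : invg_closed klein_set.
Proof.
move=> g /klein_setP[i [j ->]]; apply/klein_setP.
by exists (- i), (- (parity_sign (- i) * j)); exact: kleinV.
Qed.
HB.instance Definition _ := isMulClosed.Build _ klein_set klein_setM.
HB.instance Definition _ := isMul1Closed.Build _ klein_set klein_set1.
HB.instance Definition _ := isInvClosed.Build _ klein_set klein_setV.

Lemma klein_in i j : klein i j \in klein_set.
Proof. by apply/klein_setP; exists i, j. Qed.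

(** The two endpoints of the arcs, indexed by the integers modulo 2. *)
Definition vertex n : S1 := pi (n%:~R / 2).

Lemma klein_vertex i j n : klein i j (vertex n) = vertex (i + n).
Proof.
rewrite [LHS]circle_map_lift /vertex /line_lift; congr pi; congr (_ / _).
by rewrite mulrC divfK ?pnatr_eq0// tile_map_int.
Qed.

Lemma vertexD n k : vertex (n + 2 * k) = vertex n.
Proof.
apply/pi_circleP; rewrite intrD intrM mulrDl addrC addKr.
by rewrite mulrC mulKf ?pnatr_eq0// intr_int.
Qed.

Lemma int_parity n : exists k, n = 2 * k \/ n = 1 + 2 * k.
Proof. by exists (n %/ 2)%Z; lia. Qed.

Lemma vertex01 n : vertex n = vertex 0 \/ vertex n = vertex 1.
Proof.
have [k [->|->]] := int_parity n; [left|right]; rewrite ?vertexD//.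
by rewrite -[2 * k]add0r vertexD.
Qed.

Lemma klein_fixed i j p : klein i j p = p ->
  (exists n, p = vertex n) \/ (i = 0 /\ j = 0).
Proof.
rewrite -[p]reprK; set x := repr p => e.
have : pi (line_lift i j x) = pi x by rewrite -[LHS]circle_map_lift.
move/pi_circleP/intrP => [k kE].
have /line_lift_int_fixed[[n xE _]|] : line_lift i j x = x + k%:~R.
  by rewrite -kE addrC subrK.
- by left; exists n; rewrite /vertex -xE mulrC mulKf ?pnatr_eq0.
- by right.
Qed.

Lemma klein_fixed_card : at_most_fixed_points klein_set 2.
Proof.
move=> g /klein_setP[i [j ->]] ij1.
pose v m : S1 := vertex (if m == 0%N then 0 else 1).
have sub : [set p | homeo_fun (klein i j) p = p] `<=` v @` `I_2.
  move=> p /= /klein_fixed[[n ->]|[i0 j0]].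
    have [->|->] := vertex01 n; first by exists 0%N.
    by exists 1%N.
  by case/eqP: ij1; rewrite i0 j0 klein00.
exact: card_le_trans (subset_card_le sub) (card_image_le _ _).
Qed.

(** The action is faithful since the point 1/4 is interior to an arc. *)
Lemma klein_eq1 i j : klein i j = 1%g -> i = 0 /\ j = 0.
Proof.
move=> e; have : klein i j (pi 4^-1) = pi 4^-1 by rewrite e.
move/klein_fixed => [[n /pi_circleP/intrP[k kE]]|//]; exfalso.
have /(@intr_inj R) : (1 - 2 * n)%:~R = (4 * k)%:~R :> R.
  by rewrite intrB !intrM -kE; field.
by lia.
Qed.

Lemma klein_generated : finitely_generated klein_set.
Proof.
exists [:: klein 1 0; klein 0 1].
  by move=> g; rewrite in_cons mem_seq1 => /orP[] /eqP ->; exact: klein_in.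
move=> H sH _ /klein_setP[i [j ->]].
have g1 : klein 1 0 \in H by apply: sH; rewrite inE eqxx.
have d1 : klein 0 1 \in H by apply: sH; rewrite !inE eqxx orbT.
have gn (n : nat) : klein n 0 \in H.
  elim: n => [|n IHn]; first by rewrite klein00 gpred1.
  have -> : klein n.+1 0 = (klein n 0 * klein 1 0)%g.
    by rewrite kleinM mulr0 addr0 -addn1.
  by rewrite gpredM.
have dn (n : nat) : klein 0 n \in H.
  elim: n => [|n IHn]; first by rewrite klein00 gpred1.
  have -> : klein 0 n.+1 = (klein 0 n * klein 0 1)%g.
    by rewrite kleinM; congr klein; rewrite mul1r -addn1.
  by rewrite gpredM.
have -> : klein i j = (klein i 0 * klein 0 j)%g.
  by rewrite kleinM addr0 mulr0 add0r.
apply: gpredM.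
  case: i => n; first exact: gn.
  have -> : klein (Negz n) 0 = ((klein n.+1 0)^-1)%g.
    by rewrite kleinV mulr0 oppr0.
  by rewrite gpredV.
case: j => n; first exact: dn.
have -> : klein 0 (Negz n) = ((klein 0 n.+1)^-1)%g.
  by rewrite kleinV oppr0 mul1r.
by rewrite gpredV.
Qed.

Definition vertex_measure : set (borel_circle R) -> \bar R :=
  mscale (2^-1 : R)%:nng (measure_add
    (dirac (vertex 0 : borel_circle R)) (dirac (vertex 1 : borel_circle R))).

HB.instance Definition _ := Measure.on vertex_measure.

Lemma vertex_measureE A : vertex_measure A =
  (2^-1 * ((vertex 0 \in A)%:R + (vertex 1 \in A)%:R))%:E.
Proof.
rewrite EFinM; congr (_ * _)%E.
by rewrite [LHS]measure_addE /= !diracE -EFinD.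
Qed.

Fact vertex_measureT : vertex_measure setT = 1%E.
Proof. by rewrite vertex_measureE !in_setT mulVf ?pnatr_eq0. Qed.

HB.instance Definition _ :=
  Measure_isProbability.Build _ _ _ vertex_measure vertex_measureT.

Lemma klein_elementary : elementary klein_set.
Proof.
exists vertex_measure => _ /klein_setP[i [j ->]] A mA.
rewrite [LHS]vertex_measureE [RHS]vertex_measureE; congr ((_ * _)%:E).
have preE p : (p \in homeo_fun (klein i j) @^-1` A) = (klein i j p \in A).
  by apply/idP/idP; rewrite !inE.
rewrite !preE !klein_vertex addr0.
have [k [->|->]] := int_parity i.
  by rewrite -[2 * k]add0r vertexD addrAC vertexD.
by rewrite vertexD addrAC vertexD -(vertexD 0 1) addrC.
Qed.

End KleinGroup.

(** * Obstruction in PSL(2) *)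

Section PSL2Relation.
Variable F : fieldType.
Implicit Types A B C Y : 'M[F]_2.

Lemma mulmx2E A B i j : (A *m B) i j = A i 0 * B 0 j + A i 1 * B 1 j.
Proof.
rewrite mxE !big_ord_recl big_ord0 addr0.
by do ?[congr (_ + _)|congr (_ * _)|congr (fun_of_matrix _ _ _)]; apply/val_inj.
Qed.

Lemma mx2P A B : A 0 0 = B 0 0 -> A 0 1 = B 0 1 -> A 1 0 = B 1 0 ->
  A 1 1 = B 1 1 -> A = B.
Proof.
move=> e00 e01 e10 e11; apply/matrixP => i j.
have ord2 (k : 'I_2) : k = 0 \/ k = 1.
  by case: k => [[|[|//]] lt_k]; [left|right]; exact: val_inj.
by have [->|->] := ord2 i; have [->|->] := ord2 j.
Qed.

Lemma det_mx2 A : \det A = A 0 0 * A 1 1 - A 0 1 * A 1 0.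
Proof.
rewrite (expand_det_row _ ord0) !big_ord_recl big_ord0 addr0.
rewrite /cofactor !det_mx11.
rewrite !mxE /= expr0 expr1 mul1r mulN1r mulrN.
by congr (_ * _ - _ * _); congr (fun_of_matrix _ _ _); apply/val_inj.
Qed.

(** As [Y] is the adjugate of [C], comparing the entries of [A C] and [Y A] shows
    that the trace of [A] kills both off-diagonal entries of [C] and the
    difference of its diagonal entries.  If that trace is not 0 then [C] is
    scalar and equal to its adjugate; a matrix of determinant 1 and trace 0 has
    square -1. *)
Lemma skew_traceless A C Y : \det A = 1 -> \det C = 1 ->
  C *m Y = 1%:M -> A *m C = Y *m A -> A *m A = - 1%:M \/ C = Y.
Proof.
rewrite !det_mx2 => dA dC CY AC.
have e (M N : 'M[F]_2) i j : M = N -> M i j = N i j by move=> ->.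
have := e _ _ 0 0 CY; have := e _ _ 0 1 CY.
have := e _ _ 1 0 CY; have := e _ _ 1 1 CY.
have := e _ _ 0 0 AC; have := e _ _ 0 1 AC.
have := e _ _ 1 0 AC; have := e _ _ 1 1 AC.
rewrite !mulmx2E !mxE /=.
set a := A 0 0 in dA *; set b := A 0 1 in dA *.
set c := A 1 0 in dA *; set d := A 1 1 in dA *.
set p := C 0 0 in dC *; set q := C 0 1 in dC *.
set r := C 1 0 in dC *; set s := C 1 1 in dC *.
move=> AC11 AC10 AC01 AC00 CY11 CY10 CY01 CY00.
(* Y is the adjugate of C: the equations C Y = 1 are solved by Cramer's rule. *)
have Y00 : Y 0 0 = s.
  transitivity (s * (p * Y 0 0 + q * Y 1 0) - q * (r * Y 0 0 + s * Y 1 0)).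
    by rewrite -[LHS]mul1r -dC; ring.
  by rewrite CY00 CY10; ring.
have Y10 : Y 1 0 = - r.
  transitivity (p * (r * Y 0 0 + s * Y 1 0) - r * (p * Y 0 0 + q * Y 1 0)).
    by rewrite -[LHS]mul1r -dC; ring.
  by rewrite CY00 CY10; ring.
have Y01 : Y 0 1 = - q.
  transitivity (s * (p * Y 0 1 + q * Y 1 1) - q * (r * Y 0 1 + s * Y 1 1)).
    by rewrite -[LHS]mul1r -dC; ring.
  by rewrite CY01 CY11; ring.
have Y11 : Y 1 1 = p.
  transitivity (p * (r * Y 0 1 + s * Y 1 1) - r * (p * Y 0 1 + q * Y 1 1)).
    by rewrite -[LHS]mul1r -dC; ring.
  by rewrite CY01 CY11; ring.
rewrite Y00 Y10 Y01 Y11 in AC00 AC01 AC10 AC11.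
have [tA|tA] := eqVneq (a + d) 0.
  left; have dE : d = - a by apply/eqP; rewrite -addr_eq0 addrC tA.
  rewrite dE in dA.
  apply: mx2P; rewrite mulmx2E !mxE /= -/a -/b -/c -/d ?dE.
  - by rewrite -[1%:R]dA; ring.
  - by rewrite oppr0; ring.
  - by rewrite oppr0; ring.
  - by rewrite -[1%:R]dA; ring.
right.
have kill x : x * (a + d) = 0 -> x = 0.
  by move/eqP; rewrite mulf_eq0 (negbTE tA) orbF => /eqP.
have q0 : q = 0.
  apply: kill; transitivity (a * q + b * s - (s * b - q * d)); first by ring.
  by rewrite AC01; ring.
have r0 : r = 0.
  apply: kill; transitivity (c * p + d * r - (p * c - r * a)); first by ring.
  by rewrite AC10; ring.
have ps : p - s = 0.
  rewrite q0 r0 in AC00 AC11; apply: kill.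
  transitivity ((a * p + b * 0) - s * a - (c * 0 + d * s - p * d)).
    by ring.
  by rewrite AC00 AC11; ring.
apply: mx2P; rewrite ?Y00 ?Y01 ?Y10 ?Y11 -/p -/q -/r -/s.
- exact: subr0_eq.
- by rewrite q0 oppr0.
- by rewrite r0 oppr0.
- by apply/esym/subr0_eq.
Qed.

(** Squaring [b] removes the sign ambiguity of a lift to SL(2): the two signs
    produced by [B (B A B) B] cancel. *)
Lemma PSL2_klein_relation (a b : PSL2 F) : (b * a * b)%g = a ->
  (a * a)%g = 1%g \/ (b * b * (b * b))%g = 1%g.
Proof.
elim/quotW: a => A; elim/quotW: b => B.
have piM (X Y : SL2 F) :
    (\pi_(PSL2 F) X * \pi_(PSL2 F) Y)%g = \pi_(PSL2 F) (X * Y)%g.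
  exact: pi_PSL2M.
rewrite (piM B A) piM => /PSL2_eqP/SL2_eqpmP[e BAB].
pose C := (B * B)%g.
have CAC : val C *m val A *m val C = val A.
  transitivity (val B *m val (B * A * B)%g *m val B).
    by rewrite /= !mulmxA.
  rewrite BAB -scalemxAr -scalemxAl -[_ *m _](_ : val (B * A * B)%g = _)//.
  by rewrite BAB scalerA -expr2 sqrr_sign scale1r.
have CV : val C *m invmx (val C) = 1%:M by rewrite mulmxV ?SL2_unit.
have AC : val A *m val C = invmx (val C) *m val A.
  by rewrite -[LHS](mulKmx (SL2_unit C)) [val C *m (_ *m _)]mulmxA CAC.
have [AA|CE] := skew_traceless (SL2_det A) (SL2_det C) CV AC; [left|right].
  by rewrite (piM A A); apply/PSL2_eqP; rewrite /SL2_eqpm /= AA eqxx orbT.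
rewrite (piM B B) (piM C C); apply/PSL2_eqP; rewrite /SL2_eqpm.
have -> : val (C * C)%g = 1%:M by rewrite -[RHS]CV -CE.
by rewrite eqxx.
Qed.

End PSL2Relation.

Theorem theorem2 (R : realType) :
  exists G : groupClosed (homeo_plus R),
    [/\ forall g, g \in G -> smooth_diffeo g,
        finitely_generated G,
        elementary G,
        at_most_fixed_points G 2 &
        ~ exists H : groupClosed (PSL2 R), isomorphic_groups G H].
Proof.
exists (@klein_set R : groupClosed _); split.
- by move=> g /klein_setP[i [j ->]]; exact: klein_smooth.
- exact: klein_generated.
- exact: klein_elementary.
- exact: klein_fixed_card.
move=> [H [f [fM f_inj _]]].
have f1 : f 1%g = 1%g.
  have := fM 1%g 1%g (@klein_set1 R) (@klein_set1 R); rewrite mulg1.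
  by move/(congr1 (fun x => (f 1)^-1 * x)%g); rewrite mulKg mulVg.
have fK i j : f (@klein R i j) = 1%g -> i = 0 /\ j = 0.
  by rewrite -f1 => /(f_inj _ _ (@klein_in R i j) (@klein_set1 R)) /klein_eq1.
have fkM i j k l : (f (@klein R i j) * f (@klein R k l))%g =
    f (@klein R (i + k) (parity_sign k * j + l)).
  by rewrite -fM ?klein_in// kleinM.
have [] := @PSL2_klein_relation _ (f (@klein R 1 0)) (f (@klein R 0 1)).
- by rewrite !fkM.
- by rewrite fkM => /fK[].
- by rewrite !fkM => /fK[].
Qed.
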